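(* Let $m,n,k\ge 0$ be integers. If $m>k$ and $m>n$, then the number $M_{n,k}(m)$ of merging paths from $(0,0)$ ending at $(n,m)$ whose arrival sequence has exactly $k$ zeros is $$M_{n,k}(m)=\binom{m+n}{n-(m-k)+1}-\binom{m+n}{n-(m-k)-1}.$$
   Context: An arrival sequence of length $\ell$ is a binary string $\mathbf{b}=b_1b_2\cdots b_\ell\in\{0,1\}^\ell$. Cars $1,2,\dots,\ell$ arrive in order and choose between two initially empty lanes (left and right): if $b_i=0$, car $i$ enters the right lane; if $b_i=1$, car $i$ enters the currently shorter lane, and enters the right lane if both lanes have the same length (this last event is called a bounce). The merging path of $\mathbf{b}$ is the lattice path from $(0,0)$ whose $i$-th step is an up step $(0,1)$ if car $i$ enters the right lane (decorated if it is a bounce) and a right step $(1,0)$ if car $i$ enters the left lane; merging paths are in bijection with arrival sequences. It ends at $(n,m)$ when $n$ cars are in the left lane and $m$ are in the right lane, $m+n=\ell$. $M_{n,k}(m)$ is the number of arrival sequences of length $m+n$ with exactly $k$ zeros whose merging path ends at $(n,m)$. Binomial coefficients with negative lower index are $0$. *)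

(* Defs.v *)
From mathcomp Require Import all_boot all_order all_algebra.

Set Implicit Arguments.
Unset Strict Implicit.
Unset Printing Implicit Defensive.

(* [Up d] is the step (0,1), decorated when [d] is true; [Right] is (1,0). *)
Inductive step : Type := Up of bool | Right.

(* [car_step l r b] is the step contributed by a car with letter [b]
   ([true] for 1, [false] for 0) that finds [l] cars in the left lane and
   [r] cars in the right lane. *)
Definition car_step (l r : nat) (b : bool) : step :=
  if b then
    if l < r then Right else if r < l then Up false else Up true
  else Up false.

Definition move (p : nat * nat) (s : step) : nat * nat :=
  match s with
  | Up _ => (p.1, p.2.+1)
  | Right => (p.1.+1, p.2)
  end.

(* The current position (x, y) on the path records the lane sizes:
   x cars in the left lane and y in the right lane. *)
Fixpoint merging_path_from (p : nat * nat) (b : seq bool) : seq step :=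
  match b with
  | [::] => [::]
  | c :: b' =>
      let s := car_step p.1 p.2 c in s :: merging_path_from (move p s) b'
  end.

Definition merging_path (b : seq bool) : seq step :=
  merging_path_from (0, 0) b.

Definition path_end (w : seq step) : nat * nat := foldl move (0, 0) w.

Definition M (n k m : nat) : nat :=
  #|[set b : (m + n).-tuple bool |
      (count_mem false b == k) && (path_end (merging_path b) == (n, m))]|.

Definition binz (a : nat) (j : int) : int :=
  match j with
  | Posz i => Posz 'C(a, i)
  | Negz _ => 0%R
  end.

(* Main.v *)
Require Import Defs.
From mathcomp Require Import all_boot all_order all_algebra.
From mathcomp Require Import zify.

Import GRing.Theory.

(** Only the difference [d] of the two lanes matters: it performs a walk with
steps +1 (letter 0) and -1 (letter 1), reflected at 0 by the bounces. If a
sequence of length [len] starts at difference [d], has [k] zeros and [j] bounces,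
then [j > 0] says that the minimum of the unreflected walk is [-2j+1] or [-2j],
and [j = 0] that it is nonnegative. When the final difference is positive, the
reflection principle turns this into ['C(len, k+d+2j-1) - 'C(len, k+d+2j+1)],
respectively ['C(len, k) - 'C(len, k+d+1)]; in this form the two cases together
follow from Pascal's rule by induction on [len], looking at the first letter. *)

(** An arbitrary start [p] lets an induction remove the first letter; [M] is the case
    [p = (0, 0)]. *)
Definition paths_from (p : nat * nat) (len k : nat) (q : nat * nat) : nat :=
  #|[set b : len.-tuple bool |
      (count_mem false b == k) && (foldl move p (merging_path_from p b) == q)]|.

Lemma card_set_tupleS len (P : pred (seq bool)) :
  #|[set b : len.+1.-tuple bool | P b]| =
    #|[set b : len.-tuple bool | P (false :: b)]|
    + #|[set b : len.-tuple bool | P (true :: b)]|.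
Proof.
pose cons_pair (x : bool * len.-tuple bool) := [tuple of x.1 :: x.2].
have consK : bijective cons_pair.
  exists (fun t : len.+1.-tuple bool => (thead t, [tuple of behead t])).
    by case=> c t; congr (_, _); apply: val_inj.
  by move=> t; rewrite [RHS]tuple_eta; apply: val_inj.
rewrite -!sum1dep_card.
rewrite (reindex cons_pair) /=; last exact: onW_bij.
rewrite big_mkcond /= addnC.
rewrite -(pair_bigA _ (fun c (b : len.-tuple bool) => if P (c :: b) then 1 else 0)).
by rewrite big_bool /= -!big_mkcond.
Qed.

Lemma paths_from0 p k q : paths_from p 0 k q = (k == 0) && (p == q).
Proof.
rewrite /paths_from -sum1dep_card big_mkcond /= (big_pred1 [tuple]) /=; last first.
  by move=> t; rewrite [t]tuple0 /= eqxx.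
by rewrite eq_sym; case: ifP.
Qed.

Lemma paths_fromS l r len k q : l <= r ->
  paths_from (l, r) len.+1 k q =
    (if k is k'.+1 then paths_from (l, r.+1) len k' q else 0)
    + (if l < r then paths_from (l.+1, r) len k q
       else paths_from (l, r.+1) len k q).
Proof.
move=> le_lr; rewrite /paths_from.
rewrite (card_set_tupleS len (fun b : seq bool => (count_mem false b == k) &&
  (foldl move (l, r) (merging_path_from (l, r) b) == q))) /=.
congr (_ + _).
  case: k => [|k]; first by apply/eqP; rewrite cards_eq0; apply/eqP/setP=> b; rewrite !inE.
  by apply: eq_card => b; rewrite !inE.
by case: ltnP => [//|le_rl]; rewrite ltnNge le_lr.
Qed.

(** Each zero puts a car in the right lane, so that lane ends with at least [r + k] cars. *)
Lemma paths_from_few_up l r len k n m : l <= r -> m < r + k ->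
  paths_from (l, r) len k (n, m) = 0.
Proof.
elim: len l r k => [|len IH] l r k le_lr lt_m.
  by rewrite paths_from0 xpair_eqE; case: k lt_m => [|k] //; lia.
rewrite paths_fromS //.
have -> : (if l < r then paths_from (l.+1, r) len k (n, m)
           else paths_from (l, r.+1) len k (n, m)) = 0.
  by case: ltnP => ?; apply: IH; lia.
by case: k lt_m => [|k] lt_m //; rewrite IH //; lia.
Qed.

(** Every up step is a zero or a bounce, so height [l + d + k + j] means exactly [j] bounces. The
    subtracted binomial stands on the left to avoid truncated subtraction. *)
Lemma paths_from_bin l d len k j n : n < l + d + k + j -> n + k + j = l + len ->
  paths_from (l, l + d) len k (n, l + d + k + j) + 'C(len, k + d + j.*2.+1) =
    'C(len, if j is j'.+1 then k + d + j'.*2.+1 else k).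
Proof.
elim: len l d k j => [|len IH] l d k j lt_nm sum_n.
  rewrite paths_from0 xpair_eqE.
  rewrite [X in _ + X]bin_small; last by lia.
  case: j lt_nm sum_n => [|j] lt_nm sum_n; last by rewrite bin_small; lia.
  by case: k lt_nm sum_n => [|k] lt_nm sum_n; rewrite ?bin0 ?bin0n //=; lia.
rewrite paths_fromS ?leq_addr //.
have zero_step : (if k is k'.+1
    then paths_from (l, (l + d).+1) len k' (n, l + d + k + j) else 0)
    + 'C(len, k + d + j.*2.+1) =
    if j is j'.+1 then 'C(len, k + d + j'.*2.+1)
    else if k is k'.+1 then 'C(len, k') else 0.
  case: k lt_nm sum_n => [|k] lt_nm sum_n.
    (* With no zeros, a positive final difference makes [len] too small, and every binomial here
       vanishes. *)
    by case: j lt_nm sum_n => [|j] lt_nm sum_n; rewrite !bin_small //; lia.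
  have := IH l d.+1 k j.
  rewrite !(addnS, addSn) => -> //; try lia.
  by case: j {lt_nm sum_n}.
have one_step : (if l < l + d
    then paths_from (l.+1, l + d) len k (n, l + d + k + j)
    else paths_from (l, (l + d).+1) len k (n, l + d + k + j))
    + 'C(len, k + d + j.*2) =
    if j is j'.+1 then 'C(len, k + d + j'.*2) else 'C(len, k).
  case: d lt_nm sum_n {zero_step} => [|d] lt_nm sum_n.
    (* At difference 0 the letter 1 bounces: the difference becomes 1 and one bounce is used up,
       which is impossible for [j = 0]. *)
    rewrite addn0 ltnn; case: j lt_nm sum_n => [|j] lt_nm sum_n.
      by rewrite paths_from_few_up ?addn0 //; lia.
    have := IH l 1 k j.
    rewrite !(addnS, addSn, addn0, doubleS) => -> //; try lia.
    by case: j {lt_nm sum_n} => [|j]; rewrite ?doubleS ?addn0 ?addnS.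
  have := IH l.+1 d k j.
  rewrite !(addnS, addSn) ltnS leq_addr => -> //; try lia.
  by case: j {lt_nm sum_n} => [|j] //; rewrite addnS addSn.
case: j zero_step one_step {lt_nm sum_n} => [|j]; last by rewrite !addnS !binS; lia.
by rewrite !addnS binS; case: k => [|k]; rewrite ?bin0 ?binS; lia.
Qed.

(** This is the symmetry of binomials; for [i > a] both sides are 0. *)
Lemma binz_sub a i : (binz a (a%:Z - i%:Z) = 'C(a, i)%:Z)%R.
Proof.
case: (leqP i a) => [le_ia | lt_ai]; first by rewrite subzn //= bin_sub.
by rewrite bin_small // (_ : (_ - _)%R = Negz (i - a).-1) //; lia.
Qed.

Theorem theorem4p5 (m n k : nat) (hmk : (k < m)%N) (hmn : (n < m)%N) :
  ((M n k m)%:Z =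
     binz (m + n)%N (n%:Z - (m%:Z - k%:Z) + 1)
     - binz (m + n)%N (n%:Z - (m%:Z - k%:Z) - 1))%R.
Proof.
have := @paths_from_bin 0 0 (m + n) k (m - k) n.
rewrite !add0n !addn0 subnKC ?(ltnW hmk) // => /(_ hmn) count_eq.
have {count_eq} := count_eq ltac:(lia).
rewrite -[paths_from _ _ _ _]/(M n k m).
(* Since [k < m], there is at least one bounce, which selects the branch [j > 0] of the count. *)
have [j def_j] : exists j, m - k = j.+1 by exists (m - k).-1; lia.
rewrite def_j => count_eq.
rewrite (_ : (_ + 1)%R = ((m + n)%:Z - (k + j.*2.+1)%:Z)%R); last by lia.
rewrite (_ : (n%:Z - _ - 1)%R = ((m + n)%:Z - (k + j.+1.*2.+1)%:Z)%R); last by lia.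
by rewrite !binz_sub; lia.
Qed.
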